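(* Let $K$ be a field, let $\Delta$ be a simplicial complex on the vertex set $[n]$, and let $C\subseteq[n]$ be a vertex cover of $G_\Delta$. Then the ideal $P_C=(x_Ft : F\in\Delta_C)$ is a prime ideal in $R_\Delta$.
   Context: $[n]=\{1,\ldots,n\}$. A simplicial complex $\Delta$ on $[n]$ is a family of subsets of $[n]$ closed under taking subsets and containing all $\{i\}$, $i\in[n]$. For $F\subseteq [n]$ put $x_F=\prod_{i\in F}x_i$ (with $x_\emptyset=1$). The toric ring of $\Delta$ is the subalgebra $R_\Delta=K[x_Ft : F\in\Delta]$ of the polynomial ring $K[x_1,\ldots,x_n,t]$. $G_\Delta$ is the graph (1-skeleton) on $[n]$ whose edges are the two-element faces of $\Delta$. A vertex cover of a graph is a set of vertices meeting every edge. For $W\subseteq[n]$, $\Delta_W=\{F\in\Delta : F\subseteq W\}$. *)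

(* Defs.v *)
From HB Require Import structures.
From mathcomp Require Import all_boot all_order all_algebra.
From mathcomp Require Import boolp.
From mathcomp Require Import mpoly.

Set Implicit Arguments.
Unset Strict Implicit.
Unset Printing Implicit Defensive.

Import GRing.Theory.
Local Open Scope ring_scope.

(* The vertex set [n] = {1, ..., n} is represented by 'I_n = {0, ..., n-1}. *)
Definition simplicial_complex (n : nat) (D : {set {set 'I_n}}) : Prop :=
  (forall F G : {set 'I_n}, F \in D -> G \subset F -> G \in D) /\
  (forall i : 'I_n, [set i] \in D).

Definition skeleton1 (n : nat) (D : {set {set 'I_n}}) : rel 'I_n :=
  fun i j => (i != j) && ([set i; j] \in D).

Definition vertex_cover (n : nat) (e : rel 'I_n) (C : {set 'I_n}) : Prop :=
  forall i j : 'I_n, e i j -> (i \in C) || (j \in C).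

Definition restrict_complex (n : nat) (D : {set {set 'I_n}}) (W : {set 'I_n})
  : {set {set 'I_n}} := [set F in D | F \subset W].

(* The subalgebra generated by S, as the intersection of all the subalgebras
   containing S. *)
Definition subalg_gen (K : comNzRingType) (A : comAlgType K) (S : A -> Prop)
  : {pred A} :=
  fun p => `[< forall B : {pred A},
    subalg_closed B -> (forall g, S g -> g \in B) -> p \in B >].

Lemma subalg_gen_closed (K : comNzRingType) (A : comAlgType K)
  (S : A -> Prop) : subalg_closed (subalg_gen S).
Proof.
split=> [|a u v /asboolP hu /asboolP hv|u v /asboolP hu /asboolP hv];
  apply/asboolP => B hB hS; case: (hB) => [h1 hlin hmul].
- exact: h1.
- by apply: hlin; [exact: hu | exact: hv].
- by apply: hmul; [exact: hu | exact: hv].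
Qed.

HB.instance Definition _ (K : comNzRingType) (A : comAlgType K)
  (S : A -> Prop) :=
  GRing.isSubalgClosed.Build K A (subalg_gen S)
    (GRing.subalg_closed_semi (subalg_gen_closed S)).

Record subalg_of (K : comNzRingType) (A : comAlgType K) (S : A -> Prop) :=
  SubalgOf { subalg_val :> A; _ : subalg_val \in subalg_gen S }.

HB.instance Definition _ (K : comNzRingType) (A : comAlgType K)
  (S : A -> Prop) := [isSub for @subalg_val K A S].
HB.instance Definition _ (K : comNzRingType) (A : comAlgType K)
  (S : A -> Prop) := [Choice of subalg_of S by <:].
HB.instance Definition _ (K : comNzRingType) (A : comAlgType K)
  (S : A -> Prop) := [SubChoice_isSubComNzRing of subalg_of S by <:].
HB.instance Definition _ (K : comNzRingType) (A : comAlgType K)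
  (S : A -> Prop) := [SubZmodule_isSubLmodule of subalg_of S by <:].
HB.instance Definition _ (K : comNzRingType) (A : comAlgType K)
  (S : A -> Prop) := [SubNzRing_SubLmodule_isSubLalgebra of subalg_of S by <:].
HB.instance Definition _ (K : comNzRingType) (A : comAlgType K)
  (S : A -> Prop) := [SubLalgebra_isSubAlgebra of subalg_of S by <:].

(* K[x_1, ..., x_n, t] is {mpoly K[n.+1]}: the last variable is t, and the
   other ones are x_1, ..., x_n. *)
Definition face_mon (K : fieldType) (n : nat) (F : {set 'I_n})
  : {mpoly K[n.+1]} :=
  (\prod_(i in F) 'X_(lift ord_max i)) * 'X_(ord_max : 'I_n.+1).

Definition toric_gens (K : fieldType) (n : nat) (D : {set {set 'I_n}})
  : {mpoly K[n.+1]} -> Prop :=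
  fun p => exists2 F, F \in D & p = face_mon K F.

Definition toric_ring (K : fieldType) (n : nat) (D : {set {set 'I_n}}) : Type :=
  subalg_of (@toric_gens K n D).

HB.instance Definition _ (K : fieldType) (n : nat) (D : {set {set 'I_n}}) :=
  SubType.on (toric_ring K D).
HB.instance Definition _ (K : fieldType) (n : nat) (D : {set {set 'I_n}}) :=
  GRing.ComAlgebra.on (toric_ring K D).

Definition ideal_gen (R : comNzRingType) (S : R -> Prop) : {pred R} :=
  fun p => `[< exists2 s : seq (R * R),
    (forall c, c \in s -> S c.2) & p = \sum_(c <- s) c.1 * c.2 >].

(* idealr_closed requires 1 \notin P, so a prime ideal is proper. *)
Definition prime_ideal (R : comNzRingType) (P : {pred R}) : Prop :=
  idealr_closed P /\ prime_idealr_closed P.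

Definition cover_ideal (K : fieldType) (n : nat) (D : {set {set 'I_n}})
  (C : {set 'I_n}) : {pred toric_ring K D} :=
  ideal_gen (fun p : toric_ring K D =>
    exists2 F, F \in restrict_complex D C & val p = face_mon K F).

Arguments toric_ring K {n} D.
Arguments cover_ideal K {n} D C.

(* Main.v *)
Require Import Defs.
From HB Require Import structures.
From mathcomp Require Import all_boot all_order all_algebra.
From mathcomp Require Import boolp.
From mathcomp Require Import mpoly.
From mathcomp Require Import ring.

(** For a monomial [m] of [K[x_1, ..., x_n, t]], compare its degree in [t] with
    its degree in the variables [x_i], [i \notin C].  Since [C] is a vertex
    cover, two vertices outside [C] are never joined by an edge, so a face has
    at most one vertex outside [C] ([face_out_le1]).  Hence on a generator
    [x_F t] this outer degree is at most the [t]-degree; the two are equal when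
    [F] is not contained in [C], and the outer degree is strictly smaller when
    [F] is contained in [C] ([face_supp]).

    Both degrees are additive, so every element of the toric ring only has
    monomials whose outer degree is at most their [t]-degree
    ([toric_supp_leq]), and the elements of [P_C] only have monomials where
    this inequality is strict ([cover_ideal_supp_ltn]).  In particular [1] is
    not in [P_C].

    In the other direction, multiplying out generators writes each element of
    the toric ring as [u + v], with [u] in [P_C] and [v] balanced, i.e. with
    all its monomials of equal degrees ([toric_decomp]).  If a product of
    [u + v] and [u' + v'] is in [P_C], so is [v v'].  This product is then both
    balanced and supported on strict monomials, so it vanishes; the polynomial
    ring being a domain, [v] or [v'] is zero, and the corresponding factor is
    in [P_C].  In other words, the quotient by [P_C] is isomorphic to the
    domain of balanced elements. *)

Set Implicit Arguments.
Unset Strict Implicit.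
Unset Printing Implicit Defensive.

Import GRing.Theory.
Local Open Scope ring_scope.

Lemma subalg_gen_ind (K : comNzRingType) (A : comAlgType K) (S : A -> Prop)
    (Q : A -> Prop) :
    Q 1 -> (forall a p q, Q p -> Q q -> Q (a *: p + q)) ->
    (forall p q, Q p -> Q q -> Q (p * q)) -> (forall g, S g -> Q g) ->
  forall p, p \in subalg_gen S -> Q p.
Proof.
move=> Q1 Qlin Qmul Qgen p /asboolP /(_ (fun x => `[< Q x >])) Hp.
apply/asboolP; apply: Hp => [|g Sg]; last exact/asboolP/Qgen.
split=> [|a u v /asboolP Qu /asboolP Qv|u v /asboolP Qu /asboolP Qv];
  apply/asboolP; [exact: Q1 | exact: Qlin | exact: Qmul].
Qed.

Section IdealGen.
Variables (R : comNzRingType) (S : R -> Prop).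

Lemma ideal_gen0 : 0 \in ideal_gen S.
Proof. by apply/asboolP; exists [::] => //; rewrite big_nil. Qed.

Lemma ideal_gen_sub p : S p -> p \in ideal_gen S.
Proof.
move=> Sp; apply/asboolP; exists [:: (1, p)].
  by move=> c; rewrite inE => /eqP->.
by rewrite big_seq1 mul1r.
Qed.

Lemma ideal_genD p q :
  p \in ideal_gen S -> q \in ideal_gen S -> p + q \in ideal_gen S.
Proof.
case/asboolP=> s Ss -> /asboolP[s' Ss' ->]; apply/asboolP.
exists (s ++ s'); last by rewrite big_cat.
by move=> c; rewrite mem_cat => /orP[/Ss|/Ss'].
Qed.

Lemma ideal_genM a p : p \in ideal_gen S -> a * p \in ideal_gen S.
Proof.
case/asboolP=> s Ss ->; apply/asboolP; exists [seq (a * c.1, c.2) | c <- s].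
  by move=> c /mapP[d /Ss Sd ->].
by rewrite big_map mulr_sumr; apply: eq_bigr => c _; rewrite mulrA.
Qed.

End IdealGen.

Section Support.
Variables (K : fieldType) (n : nat) (C : {set 'I_n}).
Implicit Types (r : rel nat) (p q : {mpoly K[n.+1]}) (m : 'X_{1..n.+1}).

Definition outdeg m : nat := (\sum_(i in ~: C) m (lift ord_max i))%N.

(** The relation is a parameter because three instances interact: [leq] for
    the toric ring, [ltn] for the ideal and [eq_op] for balanced elements. *)
Definition supp_rel r p : Prop :=
  forall m, m \in msupp p -> r (outdeg m) (m ord_max).

Lemma outdegD m1 m2 : outdeg (m1 + m2)%MM = (outdeg m1 + outdeg m2)%N.
Proof. by rewrite /outdeg -big_split; apply: eq_bigr => i _; rewrite mnmDE. Qed.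

Lemma supp_rel0 r : supp_rel r 0.
Proof. by move=> m; rewrite msupp0. Qed.

Lemma supp_relD r p q : supp_rel r p -> supp_rel r q -> supp_rel r (p + q).
Proof.
by move=> rp rq m /msuppD_le; rewrite mem_cat => /orP[/rp|/rq].
Qed.

Lemma supp_relZ r a p : supp_rel r p -> supp_rel r (a *: p).
Proof. by move=> rp m /msuppZ_le /rp. Qed.

Lemma supp_relM r1 r2 r p q :
    (forall a b c d, r1 a b -> r2 c d -> r (a + c) (b + d))%N ->
  supp_rel r1 p -> supp_rel r2 q -> supp_rel r (p * q).
Proof.
move=> r12 rp rq m /msuppM_le /allpairsP[[m1 m2] /= [/rp r1m /rq r2m ->]].
by rewrite outdegD mnmDE; apply: r12.
Qed.

Lemma supp_rel1 r : supp_rel r 1 <-> r 0%N 0%N.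
Proof.
have out0 : outdeg 0%MM = 0%N by apply: big1 => i _; rewrite mnm0E.
rewrite /supp_rel msupp1; split=> [/(_ 0%MM)|r00 m].
  by rewrite inE eqxx out0 mnm0E; apply.
by rewrite inE => /eqP->; rewrite out0 mnm0E.
Qed.

Lemma balanced_strict_eq0 p : supp_rel eq_op p -> supp_rel ltn p -> p = 0.
Proof.
move=> eqp ltp; apply/mpolyP => m; rewrite mcoeff0; apply/eqP.
rewrite mcoeff_eq0; apply/negP => pm.
by move: (ltp _ pm); rewrite /= (eqP (eqp _ pm)) ltnn.
Qed.

(** The monomial of a face [F] has outer degree [#|F :\: C|] and degree [1] in
    [t]. *)
Lemma face_supp r (F : {set 'I_n}) :
  r #|F :\: C| 1%N -> supp_rel r (face_mon K F).
Proof.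
rewrite /face_mon -(big_morph _ (mpolyXD K) (mpolyX0 _ K)) -mpolyXD => rF m.
rewrite msuppX inE => /eqP->.
have lift_neq i : (lift ord_max i == ord_max :> 'I_n.+1) = false.
  by rewrite eq_sym (negbTE (neq_lift _ _)).
have -> : outdeg (\sum_(i in F) U_(lift ord_max i) + U_(ord_max))%MM
          = #|F :\: C|.
  rewrite /outdeg -sum1_card [RHS]big_mkcond [LHS]big_mkcond /=.
  apply: eq_bigr => i _; rewrite !inE mnmDE mnm_sumE mnm1E.
  rewrite [ord_max == _]eq_sym lift_neq addn0.
  case: (i \in C) => //=; rewrite big_mkcond (bigD1 i) //= big1 => [|j ji].
    by rewrite addn0 mnm1E eqxx; case: ifP.
  by rewrite mnm1E (inj_eq lift_inj) (negbTE ji); case: ifP.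
rewrite mnmDE mnm_sumE mnm1E eqxx big1 // => i _.
by rewrite mnm1E lift_neq.
Qed.

End Support.

Section Cover.
Variables (K : fieldType) (n : nat) (D : {set {set 'I_n}}) (C : {set 'I_n}).
Hypotheses (hD : simplicial_complex D) (hC : vertex_cover (skeleton1 D) C).
Local Notation P := (cover_ideal K D C).

Lemma face_out_le1 (F : {set 'I_n}) : F \in D -> (#|F :\: C| <= 1)%N.
Proof.
move=> FD; apply/card_le1_eqP => i j.
rewrite !inE => /andP[iC iF] /andP[jC jF]; apply/eqP/negPn/negP => ij.
have eij : skeleton1 D i j.
  rewrite /skeleton1 eq_sym ij /=; apply: hD.1 FD _.
  by apply/subsetP => k; rewrite !inE => /orP[] /eqP->.
by move: (hC eij); rewrite (negbTE iC) (negbTE jC).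
Qed.

Lemma toric_supp_leq (x : toric_ring K D) : supp_rel C leq (val x).
Proof.
move: (val x) (valP x); apply: subalg_gen_ind => [|a p q lp lq|p q lp lq|g].
- exact/supp_rel1.
- exact: supp_relD (supp_relZ lp) lq.
- by apply: supp_relM lp lq => a b c d; apply: leq_add.
- by case=> F FD ->; apply: face_supp; apply: face_out_le1.
Qed.

Lemma cover_ideal_supp_ltn (x : toric_ring K D) :
  x \in P -> supp_rel C ltn (val x).
Proof.
case/asboolP=> s Ss ->; rewrite big_seq.
apply: (big_ind (fun y : toric_ring K D => supp_rel C ltn (val y)))
  => [|y z ltny ltnz|c /Ss[F]].
- by rewrite rmorph0; apply: supp_rel0.
- by rewrite rmorphD; apply: supp_relD.
rewrite inE => /andP[FD FC] vF; rewrite rmorphM [X in _ * X]vF.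
apply: (supp_relM (r2 := ltn) _ (@toric_supp_leq c.1)).
  by move=> a b i j; rewrite /= -addnS; apply: leq_add.
by apply: face_supp; move: FC; rewrite -setD_eq0 => /eqP->; rewrite cards0.
Qed.

(** The decompositions form a subalgebra: in a product, only the product of
    the two balanced parts falls outside of the ideal. *)
Lemma toric_decomp (x : toric_ring K D) :
  exists u v : toric_ring K D,
    [/\ u \in P, supp_rel C eq_op (val v) & x = u + v].
Proof.
suff [u [v [Pu ev exy]]] : exists u v : toric_ring K D,
    [/\ u \in P, supp_rel C eq_op (val v) & val x = val u + val v].
  by exists u, v; split=> //; apply: val_inj; rewrite rmorphD.
move: (val x) (valP x).
apply: subalg_gen_ind => [|a _ _ [u [v [Pu ev ->]]] [u' [v' [Pu' ev' ->]]]
    |_ _ [u [v [Pu ev ->]]] [u' [v' [Pu' ev' ->]]]|g gen_g].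
- exists 0, 1; rewrite rmorph0 rmorph1 add0r.
  by split=> //; [exact: ideal_gen0 | exact/supp_rel1].
- exists (a *: u + u'), (a *: v + v'); split.
  + by apply: ideal_genD Pu'; rewrite -mulr_algl; apply: ideal_genM.
  + by rewrite linearP; apply: supp_relD ev'; apply: supp_relZ.
  + by rewrite !linearP scalerDr addrACA.
- exists ((u' + v') * u + v * u'), (v * v'); split.
  + by apply: ideal_genD; apply: ideal_genM.
  + rewrite rmorphM; apply: supp_relM ev ev' => a b c d.
    by move=> /eqP-> /eqP->.
  + by rewrite !(rmorphD, rmorphM) /= mulrDl mulrDr; ring.
case: (gen_g) => F FD eg.
have Rg : g \in subalg_gen (@toric_gens K n D).
  by apply/asboolP => B _; apply.
pose y : toric_ring K D := SubalgOf Rg.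
have [FC|nFC] := boolP (F \subset C).
  exists y, 0; rewrite rmorph0 addr0; split=> //; last exact: supp_rel0.
  by apply: ideal_gen_sub; exists F; rewrite // inE FD.
exists 0, y; rewrite rmorph0 add0r; split=> //; first exact: ideal_gen0.
rewrite /= eg; apply: face_supp.
by rewrite eqn_leq face_out_le1 // card_gt0 setD_eq0.
Qed.

End Cover.

Theorem theorem1p3 (K : fieldType) (n : nat) (D : {set {set 'I_n}})
    (C : {set 'I_n})
    (hD : simplicial_complex D) (hC : vertex_cover (skeleton1 D) C) :
  prime_ideal (cover_ideal K D C).
Proof.
split; first split.
- exact: ideal_gen0.
- by apply/negP => /(cover_ideal_supp_ltn hD hC); rewrite rmorph1 => /supp_rel1.
- by move=> a u v Pu Pv; apply: ideal_genD Pv; apply: ideal_genM.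
move=> x y; have [u [v [Pu ev ->]]] := toric_decomp hD hC x.
have [u' [v' [Pu' ev' ->]]] := toric_decomp hD hC y => Pxy.
have Pvv : v * v' \in cover_ideal K D C.
  have -> : v * v' = (u + v) * (u' + v') + (- (u' + v') * u + - v * u').
    by ring.
  by apply: ideal_genD Pxy _; apply: ideal_genD; apply: ideal_genM.
have /eqP : val v * val v' = 0.
  apply: (@balanced_strict_eq0 _ _ C).
    by apply: supp_relM ev ev' => a b c d /eqP-> /eqP->.
  by have := cover_ideal_supp_ltn hD hC Pvv; rewrite rmorphM.
rewrite mulf_eq0 => /orP[] /eqP v0; apply/orP; [left|right].
  by have -> : v = 0 by [apply: val_inj; rewrite v0 rmorph0]; rewrite addr0.
by have -> : v' = 0 by [apply: val_inj; rewrite v0 rmorph0]; rewrite addr0.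
Qed.
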